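(* Let $\mathcal{H}_A,\mathcal{H}_B$ be complex Hilbert spaces of finite dimensions $d_A\le d_B$. Suppose that $\{\Pi^A_\alpha\}_{\alpha=0}^{d_A^2-1}$ and $\{\Pi^B_\beta\}_{\beta=0}^{d_B^2-1}$ are SIC POVMs in $\mathcal{H}_A$ and $\mathcal{H}_B$, respectively. Let $\rho$ be a density operator on $\mathcal{H}_A\otimes\mathcal{H}_B$, let $P$ be the $d_A^2\times d_B^2$ matrix $P_{\alpha\beta}=\mathrm{Tr}(\rho\,\Pi^A_\alpha\otimes\Pi^B_\beta)$, and let $C^{\rm can}_{\alpha\beta}=\mathrm{Tr}(\rho\,G^A_\alpha\otimes G^B_\beta)$ be the correlation matrix of $\rho$ with respect to canonical bases $\{G^A_\alpha\}$, $\{G^B_\beta\}$. Then $$\sqrt{d_A(d_A+1)\,d_B(d_B+1)}\;\|P\|_{\rm tr}=\|D^A_x\,C^{\rm can}\,D^B_y\|_{\rm tr}\qquad\text{with } (x,y)=(\sqrt{d_A+1},\sqrt{d_B+1}).$$ Consequently the ESIC condition $$\|P\|_{\rm tr}\le \frac{2}{\sqrt{d_A(d_A+1)d_B(d_B+1)}}$$ is equivalent to $\|D^A_x C^{\rm can}D^B_y\|_{\rm tr}\le 2$ with these values of $(x,y)$. Moreover, for arbitrary finite $d_A\le d_B$, without assuming existence of SIC POVMs in $\mathcal{H}_A$ or $\mathcal{H}_B$, every separable $\rho$ satisfies $\|D^A_x C^{\rm can}D^B_y\|_{\rm tr}\le 2$ with $(x,y)=(\sqrt{d_A+1},\sqr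t{d_B+1})$.
   Context: A SIC POVM in a $d$-dimensional Hilbert space is a family of $d^2$ rank-one operators $\Pi_i=\frac1d|\psi_i\rangle\langle\psi_i|$ with $|\langle\psi_i|\psi_j\rangle|^2=\frac{d\,\delta_{ij}+1}{d+1}$ for all $i,j$ and $\sum_{i}\Pi_i=\mathbb{1}_d$. A density operator is a positive semidefinite operator of trace one. A density operator $\rho$ on $\mathcal{H}_A\otimes\mathcal{H}_B$ is separable if $\rho=\sum_k p_k\,\rho^A_k\otimes\rho^B_k$ (a finite sum) with $(p_k)$ a probability distribution and $\rho^A_k,\rho^B_k$ density operators on $\mathcal{H}_A,\mathcal{H}_B$. A canonical basis of $\mathcal{B}(\mathcal{H})$ (with $\dim\mathcal{H}=d$) is a basis $\{G_\alpha\}_{\alpha=0}^{d^2-1}$ of Hermitian operators, orthonormal for the Hilbert-Schmidt inner product $\langle X|Y\rangle_{\rm HS}=\mathrm{Tr}(X^\dagger Y)$, with $G_0=\mathbb{1}/\sqrt{d}$. $D^A_x=\mathrm{diag}\{x,1,\dots,1\}$ is the $d_A^2\times d_A^2$ diagonal matrix, and $D^B_y=\mathrm{diag}\{y,1,\dots,1\}$ is the $d_B^2\times d_B^2$ diagonal matrix (the first entry corresponds to index $0$). The trace norm is $\|X\|_{\rm tr}=\mathrm{Tr}\sqrt{XX^\dagger}$. *)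

(* Defs.v *)
From mathcomp Require Import all_boot all_order all_algebra.
From mathcomp Require Import spectral sesquilinear.
From mathcomp Require Import reals complex mxtens.

Set Implicit Arguments.
Unset Strict Implicit.
Unset Printing Implicit Defensive.

Import Order.TTheory GRing.Theory Num.Theory.
Local Open Scope ring_scope.

(* The Hilbert space of dimension d is C^d: kets are column vectors, operators
   are matrices, and C^dA (x) C^dB is C^(dA * dB) with operators [A *t B]. *)
Section Definitions.
Variable C : numClosedFieldType.

Definition adjmx m n (A : 'M[C]_(m, n)) : 'M[C]_(n, m) := map_mx Num.conj A^T.

(* [0 <= z] in C means that z is real and nonnegative. *)
Definition psdmx n (A : 'M[C]_n) : Prop :=
  A \is hermsymmx /\ forall v : 'cV[C]_n, 0 <= (adjmx v *m A *m v) 0 0.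

Definition density n (rho : 'M[C]_n) : Prop := psdmx rho /\ \tr rho = 1.

Definition separable dA dB (rho : 'M[C]_(dA * dB)) : Prop :=
  exists (n : nat) (p : 'I_n -> C)
         (rhoA : 'I_n -> 'M[C]_dA) (rhoB : 'I_n -> 'M[C]_dB),
    [/\ forall k, 0 <= p k, \sum_k p k = 1,
        forall k, density (rhoA k), forall k, density (rhoB k)
      & rho = \sum_k p k *: (rhoA k *t rhoB k)].

Definition is_sic_povm d (Pi : 'I_(d ^ 2) -> 'M[C]_d) : Prop :=
  exists psi : 'I_(d ^ 2) -> 'cV[C]_d,
    [/\ forall i, Pi i = d%:R^-1 *: (psi i *m adjmx (psi i)),
        forall i j, `|(adjmx (psi i) *m psi j) 0 0| ^+ 2
                    = (d%:R * (i == j)%:R + 1) / (d%:R + 1)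
      & \sum_i Pi i = 1%:M].

Definition hs_inner d (X Y : 'M[C]_d) : C := \tr (adjmx X *m Y).

Definition is_canonical_basis d (G : 'I_(d ^ 2) -> 'M[C]_d) : Prop :=
  [/\ basis_of fullv [tuple G i | i < d ^ 2],
      forall i, G i \is hermsymmx,
      forall i j, hs_inner (G i) (G j) = (i == j)%:R
    & forall i : 'I_(d ^ 2), i = 0%N :> nat -> G i = (sqrtC d%:R)^-1 *: 1%:M].

Definition correlation_mx dA dB (rho : 'M[C]_(dA * dB))
    (EA : 'I_(dA ^ 2) -> 'M[C]_dA) (EB : 'I_(dB ^ 2) -> 'M[C]_dB) :
    'M[C]_(dA ^ 2, dB ^ 2) :=
  \matrix_(a, b) \tr (rho *m (EA a *t EB b)).

Definition Dmx d (x : C) : 'M[C]_(d ^ 2) :=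
  diag_mx (\row_(i < d ^ 2) if i == 0%N :> nat then x else 1).

(* Square root by functional calculus: for normal A = U^-1 diag(l) U with U
   unitary, U^-1 diag(sqrt l) U; see [mxsqrt_psd] and [mxsqrtK]. *)
Definition mxsqrt n (A : 'M[C]_n) : 'M[C]_n :=
  invmx (spectralmx A) *m diag_mx (map_mx sqrtC (spectral_diag A))
    *m spectralmx A.

Definition trnorm m n (X : 'M[C]_(m, n)) : C := \tr (mxsqrt (X *m adjmx X)).

Lemma psdmx_mul_adj m n (X : 'M[C]_(m, n)) : psdmx (X *m adjmx X).
Proof.
split=> [|v].
  apply/is_hermitianmxP; rewrite /= expr0 scale1r.
  apply/matrixP=> i j; rewrite !mxE rmorph_sum; apply: eq_bigr => k _.
  by rewrite !mxE rmorphM /= conjCK mulrC.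
rewrite mulmxA -mulmxA mxE; apply: sumr_ge0 => i _.
suff -> : (adjmx v *m X) 0 i = Num.conj ((adjmx X *m v) i 0).
  by rewrite mulrC mul_conjC_ge0.
rewrite !mxE rmorph_sum; apply: eq_bigr => k _.
by rewrite !mxE rmorphM /= conjCK mulrC.
Qed.

Lemma spectral_diag_psd n (A : 'M[C]_n) : psdmx A ->
  forall i, 0 <= spectral_diag A 0 i.
Proof.
move=> [hA pA] i; have /orthomx_spectralP eA := hermitian_normalmx hA.
pose P := spectralmx A; have uP : P \is unitarymx := spectral_unitarymx A.
have := pA (adjmx (row i P)).
have -> : adjmx (adjmx (row i P)) = row i P.
  by apply/matrixP=> a b; rewrite !mxE conjCK.
rewrite -row_mul; suff -> : P *m A = diag_mx (spectral_diag A) *m P.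
  rewrite row_mul -mulmxA.
  have -> : P *m adjmx (row i P) = col i 1%:M.
    have /unitarymxP <- := uP.
    by apply/matrixP=> a b; rewrite !mxE; apply: eq_bigr => k _; rewrite !mxE.
  rewrite mxE (bigD1 i) //= big1 ?addr0; last first.
    by move=> j ji; rewrite !mxE eq_sym (negPf ji) mulr0n mul0r.
  by rewrite !mxE eqxx mulr1 mulr1n.
by rewrite [in LHS]eA !mulmxA mulmxV ?spectral_unit // mul1mx.
Qed.

Lemma mxsqrt_psd n (A : 'M[C]_n) : psdmx A -> psdmx (mxsqrt A).
Proof.
move=> psdA; have ge0 := spectral_diag_psd psdA.
have uP := spectral_unitarymx A.
pose d := diag_mx (map_mx (fun z => sqrtC (sqrtC z)) (spectral_diag A)).
suff -> : mxsqrt A =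
    (adjmx (spectralmx A) *m d) *m adjmx (adjmx (spectralmx A) *m d).
  exact: psdmx_mul_adj.
have -> : adjmx (adjmx (spectralmx A) *m d) = d *m spectralmx A.
  apply/matrixP=> a b; rewrite !mxE rmorph_sum; apply: eq_bigr => k _.
  rewrite !mxE rmorphM /= conjCK mulrC; congr (_ * _).
  have [->|ka] := eqVneq a k; last by rewrite !mulr0n rmorph0.
  by rewrite !mulr1n geC0_conj // !sqrtC_ge0.
have -> : adjmx (spectralmx A) = invmx (spectralmx A) by rewrite invmx_unitary.
rewrite !mulmxA -[_ *m d *m d]mulmxA mulmx_diag /mxsqrt.
congr (_ *m diag_mx _ *m _).
by apply/rowP=> k; rewrite !mxE -expr2 sqrtCK.
Qed.

Lemma mxsqrtK n (A : 'M[C]_n) : psdmx A -> mxsqrt A *m mxsqrt A = A.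
Proof.
move=> [hA _]; have /orthomx_spectralP eA := hermitian_normalmx hA.
rewrite {3}eA /mxsqrt !mulmxA mulmxK ?spectral_unit //.
rewrite -[_ *m diag_mx _ *m diag_mx _]mulmxA mulmx_diag.
congr (_ *m diag_mx _ *m _).
by apply/rowP=> k; rewrite !mxE -expr2 sqrtCK.
Qed.

End Definitions.

(* Main.v *)
(** Expanding a SIC POVM in a canonical basis, sqrt(d(d+1)) times its coordinate
    matrix is a unitary times diag(sqrt(d+1), 1, ..., 1), so c P and
    D_x C^can D_y differ by unitaries on both sides and have the same trace norm.
    For a product state a (x) b the matrix D_x C^can D_y is u v^T, where by
    Parseval |u|^2 = Tr(a^2) + 1 <= 2 and likewise for v.  Writing the trace norm
    as Tr(X W) with a contraction W, a convex combination of such matrices has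
    trace norm at most 2. *)
Require Import Defs.
From mathcomp Require Import all_boot all_order all_algebra.
From mathcomp Require Import spectral sesquilinear.
From mathcomp Require Import reals complex mxtens.
From mathcomp Require Import ring.

Set Implicit Arguments.
Unset Strict Implicit.
Unset Printing Implicit Defensive.

Import Order.TTheory GRing.Theory Num.Theory.
Local Open Scope ring_scope.
Local Open Scope sesquilinear_scope.

(** * The trace norm: unitary invariance, duality with contractions, convex combinations *)

Section TraceNorm.
Variable C : numClosedFieldType.

Lemma adjmxE m n (A : 'M[C]_(m, n)) i j : adjmx A i j = (A j i)^*.
Proof. by rewrite !mxE. Qed.

Lemma adjmx_mul m n p (A : 'M[C]_(m, n)) (B : 'M[C]_(n, p)) :
  adjmx (A *m B) = adjmx B *m adjmx A.
Proof. by rewrite /adjmx trmx_mul map_mxM. Qed.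

Lemma adjmxK m n (A : 'M[C]_(m, n)) : adjmx (adjmx A) = A.
Proof. by apply/matrixP => i j; rewrite !adjmxE conjCK. Qed.

Lemma adjmx_herm n (A : 'M[C]_n) : A \is hermsymmx -> adjmx A = A.
Proof. by move=> /is_hermitianmxP; rewrite /= expr0 scale1r => {2}->. Qed.

Lemma adjmx_mulE n (u : 'cV[C]_n) :
  (adjmx u *m u) 0 0 = \sum_i `|u i 0| ^+ 2.
Proof. by rewrite mxE; apply: eq_bigr => i _; rewrite adjmxE mulrC -normCK. Qed.

(* The functional calculus does not depend on the diagonalization: conjugating
   by [spectralmx A *m invmx P] intertwines the two diagonal matrices, hence
   also their entrywise square roots. *)
Lemma mxsqrt_diag n (A P : 'M[C]_n) (d : 'rV[C]_n) :
  A \is hermsymmx -> P \in unitmx -> A = invmx P *m diag_mx d *m P ->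
  mxsqrt A = invmx P *m diag_mx (map_mx sqrtC d) *m P.
Proof.
move=> hA uP eA; have /orthomx_spectralP eA' := hermitian_normalmx hA.
rewrite /mxsqrt; set Q := spectralmx A in eA' *; set e := spectral_diag A in eA' *.
have uQ : Q \in unitmx by apply: spectral_unit.
pose W := Q *m invmx P.
have eW : diag_mx e *m W = W *m diag_mx d.
  have : Q *m A *m invmx P = Q *m A *m invmx P by [].
  by rewrite {1}eA' eA !mulmxA mulmxV // mul1mx mulmxK // => <-; rewrite mulmxA.
have sW : diag_mx (map_mx sqrtC e) *m W = W *m diag_mx (map_mx sqrtC d).
  move: (W) eW => M /matrixP eM; apply/matrixP => i j; move: (eM i j).
  rewrite !mul_diag_mx !mul_mx_diag !mxE.
  (* Where [M i j] is nonzero, the intertwining relation forces the eigenvalues [e 0 i] and [d 0 j]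
     to coincide, hence so do their roots. *)
  have [->|nz] := eqVneq (M i j) 0; first by rewrite !mulr0 !mul0r.
  by rewrite mulrC => /(mulfI nz) ->; rewrite mulrC.
have -> : Q = W *m P by rewrite mulmxKV.
rewrite -mulmxA (mulmxA _ W) sW -!mulmxA mulmxA.
by rewrite /W mulmxKV // (mulmxA (invmx Q)) mulVmx // mul1mx.
Qed.

Lemma hermsymmx_mul_adj m n (X : 'M[C]_(m, n)) : X *m adjmx X \is hermsymmx.
Proof. by have [] := psdmx_mul_adj X. Qed.

Lemma spectral_mul_adj m n (X : 'M[C]_(m, n)) (A := X *m adjmx X) :
  A = invmx (spectralmx A) *m diag_mx (spectral_diag A) *m spectralmx A.
Proof. exact/orthomx_spectralP/hermitian_normalmx/hermsymmx_mul_adj. Qed.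

Lemma trnorm_diag m n (X : 'M[C]_(m, n)) (P : 'M[C]_m) (d : 'rV[C]_m) :
  P \in unitmx -> X *m adjmx X = invmx P *m diag_mx d *m P ->
  trnorm X = \sum_i sqrtC (d 0 i).
Proof.
move=> uP eX; rewrite /trnorm (mxsqrt_diag _ uP eX) ?hermsymmx_mul_adj //.
rewrite mxtrace_mulC mulmxA mulmxV // mul1mx mxtrace_diag.
by apply: eq_bigr => i _; rewrite mxE.
Qed.

Lemma trnormE m n (X : 'M[C]_(m, n)) :
  trnorm X = \sum_i sqrtC (spectral_diag (X *m adjmx X) 0 i).
Proof. by apply: trnorm_diag (spectral_unit _) _; apply: spectral_mul_adj. Qed.

Lemma trnorm_ge0 m n (X : 'M[C]_(m, n)) : 0 <= trnorm X.
Proof.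
rewrite trnormE sumr_ge0 // => i _; rewrite sqrtC_ge0.
exact/spectral_diag_psd/psdmx_mul_adj.
Qed.

Lemma mul_adj_unitary n (U : 'M[C]_n) : U \is unitarymx -> U *m adjmx U = 1%:M.
Proof. by move/unitarymxP. Qed.

Lemma adj_mul_unitary n (U : 'M[C]_n) : U \is unitarymx -> adjmx U *m U = 1%:M.
Proof. by move=> uU; apply: mulmx1C; apply: mul_adj_unitary. Qed.

(** [V] cancels in the product of the matrix with its adjoint, and [U] only rotates the eigenbasis,
    so the eigenvalues are unchanged. *)
Lemma trnorm_unitary m n (U : 'M[C]_m) (X : 'M[C]_(m, n)) (V : 'M[C]_n) :
  U \is unitarymx -> V \is unitarymx -> trnorm (U *m X *m V) = trnorm X.
Proof.
move=> uU uV; rewrite (trnormE X).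
set A := X *m _; set P := spectralmx A.
have uP : P \is unitarymx := spectral_unitarymx A.
have uQ : P *m adjmx U \is unitarymx by rewrite mul_unitarymx // trmxC_unitary.
apply: (@trnorm_diag _ _ _ (P *m adjmx U)); first exact: unitarymx_unit.
rewrite invmx_unitary // -[_^t*]/(adjmx _) !adjmx_mul adjmxK !mulmxA.
rewrite -(mulmxA _ V) mul_adj_unitary // mulmx1 -(mulmxA U X) -/A.
by rewrite {1}[A](spectral_mul_adj X) -/A -/P invmx_unitary // !mulmxA.
Qed.

Lemma trnorm_scale m n (c : C) (X : 'M[C]_(m, n)) :
  0 <= c -> trnorm (c *: X) = c * trnorm X.
Proof.
move=> c0; rewrite (trnormE X).
set A := X *m adjmx X.
have := @trnorm_diag _ _ (c *: X) (spectralmx A) (c ^+ 2 *: spectral_diag A).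
move=> ->; last 2 first.
- exact: spectral_unit.
- have -> : adjmx (c *: X) = c *: adjmx X.
    by apply/matrixP => i j; rewrite !mxE rmorphM /= geC0_conj.
  rewrite -scalemxAl -scalemxAr scalerA -expr2 [in LHS](spectral_mul_adj X).
  by rewrite -/A linearZ /= -scalemxAr -scalemxAl.
rewrite mulr_sumr; apply: eq_bigr => i _; rewrite !mxE.
rewrite sqrtCM ?nnegrE ?exprn_ge0 ?sqrCK //.
exact/spectral_diag_psd/psdmx_mul_adj.
Qed.

Lemma unitary_norm n (U : 'M[C]_n) (u : 'cV[C]_n) : U \is unitarymx ->
  \sum_i `|(U *m u) i 0| ^+ 2 = \sum_i `|u i 0| ^+ 2.
Proof.
move=> uU; rewrite -!adjmx_mulE adjmx_mul mulmxA -(mulmxA _ (adjmx U)).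
by rewrite adj_mul_unitary // mulmx1.
Qed.

(* [W] is the adjoint of the partial isometry in the polar decomposition of
   [X]; inverting a zero singular value gives 0, as the construction needs. *)
Lemma trnorm_dual m n (X : 'M[C]_(m, n)) :
  exists2 W : 'M[C]_(n, m), trnorm X = \tr (X *m W) &
    forall u : 'cV[C]_m, \sum_i `|(W *m u) i 0| ^+ 2 <= \sum_i `|u i 0| ^+ 2.
Proof.
set A := X *m adjmx X; set P := spectralmx A; pose l := spectral_diag A.
have uP : P \is unitarymx := spectral_unitarymx A.
have l0 i : 0 <= l 0 i by apply/spectral_diag_psd/psdmx_mul_adj.
have eA : A = adjmx P *m diag_mx l *m P.
  by rewrite {1}[A](spectral_mul_adj X) -/A -/P invmx_unitary.
pose D := diag_mx (\row_i (sqrtC (l 0 i))^-1).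
have aD : adjmx D = D.
  apply/matrixP => i j; rewrite adjmxE !mxE eq_sym.
  have [->|_] := eqVneq i j; last by rewrite !mulr0n rmorph0.
  by rewrite !mulr1n geC0_conj // invr_ge0 sqrtC_ge0.
exists (adjmx X *m (adjmx P *m D *m P)) => [|u].
  rewrite mulmxA -/A eA !mulmxA -(mulmxA _ P) mul_adj_unitary // mulmx1.
  rewrite mxtrace_mulC !mulmxA mul_adj_unitary // mul1mx mulmx_diag mxtrace_diag.
  rewrite trnormE; apply: eq_bigr => i _; rewrite !mxE -/A -/l.
  have [->|nz] := eqVneq (l 0 i) 0; first by rewrite sqrtC0 mul0r.
  by rewrite -{2}(sqrtCK (l 0 i)) expr2 mulfK // sqrtC_eq0.
rewrite -(unitary_norm u uP) -adjmx_mulE.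
set v := P *m u.
rewrite !adjmx_mul !adjmxK aD.
have -> : adjmx u *m (adjmx P *m (D *m P) *m X) *m
    (adjmx X *m (adjmx P *m D *m P) *m u) =
    adjmx v *m (D *m (P *m A *m adjmx P) *m D) *m v.
  by rewrite /v /A adjmx_mul !mulmxA.
have -> : P *m A *m adjmx P = diag_mx l.
  rewrite eA !mulmxA mul_adj_unitary // mul1mx -(mulmxA _ P).
  by rewrite mul_adj_unitary // mulmx1.
(* The middle factor [D *m diag_mx l *m D] is diagonal with entries 0 or 1, so the bound holds term
   by term. *)
move: v => v; rewrite /D -!mulmxA mxE ler_sum // => i _.
rewrite adjmxE !mul_diag_mx !mxE.
have [->|nz] := eqVneq (l 0 i) 0.
  by rewrite mul0r !mulr0 exprn_ge0.
rewrite -{2}(sqrtCK (l 0 i)) expr2 !mulrA.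
have s0 : sqrtC (l 0 i) != 0 by rewrite sqrtC_eq0.
by rewrite mulfVK // mulfK // -normCKC.
Qed.

Lemma norm_mul_le (a b : C) : `|a * b| <= (`|a| ^+ 2 + `|b| ^+ 2) / 2.
Proof.
rewrite ler_pdivlMr // normrM -subr_ge0.
have -> : `|a| ^+ 2 + `|b| ^+ 2 - `|a| * `|b| * 2 = (`|a| - `|b|) ^+ 2.
  by rewrite sqrrB mulr_natr addrAC.
by rewrite real_exprn_even_ge0 // rpredB ?normr_real.
Qed.

(** A single contraction [W], dual to the whole sum, serves every term, so no triangle inequality
    for the trace norm is needed: each term contributes the scalar [v^T *m W *m u], which the
    arithmetic-geometric mean inequality bounds by [b]. *)
Lemma trnorm_convex_rank1 m n N (p : 'I_N -> C)
    (u : 'I_N -> 'cV[C]_m) (v : 'I_N -> 'cV[C]_n) (b : C) :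
  (forall k, 0 <= p k) -> \sum_k p k = 1 ->
  (forall k, \sum_i `|u k i 0| ^+ 2 <= b) ->
  (forall k, \sum_i `|v k i 0| ^+ 2 <= b) ->
  trnorm (\sum_k p k *: (u k *m (v k)^T)) <= b.
Proof.
move=> p0 p1 ub vb; set M := \sum_k _; have [W eW leW] := trnorm_dual M.
rewrite -(ger0_norm (trnorm_ge0 M)) eW mulmx_suml raddf_sum /=.
rewrite -[b]mul1r -p1 mulr_suml (le_trans (ler_norm_sum _ _ _)) // ler_sum // => k _.
rewrite -scalemxAl linearZ /= normrM ger0_norm // ler_wpM2l //.
rewrite -mulmxA mxtrace_mulC -mulmxA trace_mx11 mxE.
apply: le_trans (ler_norm_sum _ _ _) _.
apply: (@le_trans _ _ (\sum_i (`|v k i 0| ^+ 2 + `|(W *m u k) i 0| ^+ 2) / 2)).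
  by apply: ler_sum => i _; rewrite [(v k)^T _ _]mxE norm_mul_le.
rewrite -mulr_suml big_split /= ler_pdivrMr // mulr_natr mulr2n.
by rewrite lerD // (le_trans (leW _)).
Qed.

End TraceNorm.

(** * Coordinates in a canonical basis and the norm bound for density operators *)

Section CanonicalBasis.
Variable C : numClosedFieldType.

Lemma hs_inner_sumr d I (r : seq I) (a : I -> C) (X : 'M[C]_d) (Y : I -> 'M[C]_d) :
  hs_inner X (\sum_(i <- r) a i *: Y i) = \sum_(i <- r) a i * hs_inner X (Y i).
Proof.
rewrite /hs_inner mulmx_sumr raddf_sum; apply: eq_bigr => i _ /=.
by rewrite -scalemxAr linearZ.
Qed.

Lemma hs_innerC d (X Y : 'M[C]_d) : (hs_inner X Y)^* = hs_inner Y X.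
Proof.
have trA (Z : 'M[C]_d) : (\tr Z)^* = \tr (adjmx Z).
  by rewrite rmorph_sum; apply: eq_bigr => i _; rewrite adjmxE.
by rewrite /hs_inner trA adjmx_mul adjmxK.
Qed.

Variables (d : nat) (G : 'I_(d ^ 2) -> 'M[C]_d).
Hypothesis hG : is_canonical_basis G.

Lemma canonical_basis_expand X : X = \sum_i hs_inner (G i) X *: G i.
Proof.
have [bG _ oG _] := hG.
have eX := coord_basis bG (memvf X).
pose a i := coord [tuple G i | i < d ^ 2] i X.
have {}eX : X = \sum_i a i *: G i.
  by rewrite {1}eX; apply: eq_bigr => i _; rewrite -tnth_nth tnth_mktuple.
rewrite {1}eX; apply: eq_bigr => i _; rewrite [in RHS]eX hs_inner_sumr.
rewrite (bigD1 i) //= oG eqxx mulr1 big1 ?addr0 // => j ji.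
by rewrite oG eq_sym (negPf ji) mulr0.
Qed.

Lemma hs_inner_parseval X Y :
  hs_inner Y X = \sum_i hs_inner (G i) X * (hs_inner (G i) Y)^*.
Proof.
rewrite {1}(canonical_basis_expand X) hs_inner_sumr.
by apply: eq_bigr => i _; rewrite hs_innerC.
Qed.

Lemma hs_inner_canonical X i : hs_inner (G i) X = \tr (X *m G i).
Proof.
by have [_ hermG _ _] := hG; rewrite /hs_inner adjmx_herm // mxtrace_mulC.
Qed.

Lemma hs_inner_canonical0 X (i : 'I_(d ^ 2)) :
  i = 0%N :> nat -> hs_inner (G i) X = (sqrtC d%:R)^-1 * \tr X.
Proof.
have [_ _ _ G0] := hG; move=> /G0 Gi.
by rewrite hs_inner_canonical Gi -scalemxAr mulmx1 linearZ.
Qed.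

Lemma Dmx_mulE m (x : C) (A : 'M[C]_(d ^ 2, m)) i j :
  (Dmx d x *m A) i j = (if i == 0%N :> nat then x else 1) * A i j.
Proof. by rewrite mul_diag_mx !mxE. Qed.

Lemma mul_DmxE m (x : C) (A : 'M[C]_(m, d ^ 2)) i j :
  (A *m Dmx d x) i j = A i j * (if j == 0%N :> nat then x else 1).
Proof. by rewrite mul_mx_diag !mxE. Qed.

(** The eigenvalues are nonnegative with sum 1, so each is at most 1 and dominates its own
    square. *)
Lemma density_purity_le1 n (r : 'M[C]_n) : density r -> hs_inner r r <= 1.
Proof.
move=> [pr tr1]; have l0 := spectral_diag_psd pr; have [hr _] := pr.
have /orthomx_spectralP er := hermitian_normalmx hr.
set P := spectralmx r in er; set l := spectral_diag r in er l0.
have uP : P \in unitmx by apply: spectral_unit.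
have trE (D : 'M[C]_n) : \tr (invmx P *m D *m P) = \tr D.
  by rewrite mxtrace_mulC mulmxA mulmxV // mul1mx.
have sl : \sum_i l 0 i = 1 by rewrite -tr1 er trE mxtrace_diag.
have -> : hs_inner r r = \sum_i l 0 i ^+ 2.
  rewrite /hs_inner adjmx_herm // er !mulmxA mulmxK //.
  rewrite -(mulmxA _ (diag_mx l) (diag_mx l)) trE mulmx_diag mxtrace_diag.
  by apply: eq_bigr => i _; rewrite mxE.
rewrite -sl; apply: ler_sum => i _; rewrite expr2 ler_piMr // -sl.
by rewrite (bigD1 i) //= lerDl sumr_ge0.
Qed.

Hypothesis d_gt0 : (0 < d)%N.

Let o : 'I_(d ^ 2) := Ordinal (etrans (expn_gt0 d 2) (introT orP (or_introl d_gt0))).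

Let d_neq0 : d%:R != 0 :> C. Proof. by rewrite pnatr_eq0 -lt0n. Qed.

Let d1_neq0 : d%:R + 1 != 0 :> C. Proof. by rewrite natr1 pnatr_eq0. Qed.

(** Coordinate 0 has square 1/d; the weight turns it into (d+1)/d = 1/d + 1. Weighting thus adds
    exactly 1 to the Parseval sum, which is the purity. *)
Lemma density_coord_norm (r : 'M[C]_d) :
  density r ->
  \sum_i `|(Dmx d (sqrtC (d%:R + 1)) *m \col_i \tr (r *m G i)) i 0| ^+ 2 <= 2.
Proof.
move=> dr; have [_ tr1] := dr.
have -> : 2 = 1 + 1 :> C by rewrite -(natrD _ 1 1).
apply: le_trans (lerD (density_purity_le1 dr) (lexx 1)).
have norm0 (z : C) : 0 <= z -> `|sqrtC z| ^+ 2 = z.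
  by move=> z0; rewrite ger0_norm ?sqrtC_ge0 // sqrtCK.
rewrite hs_inner_parseval (bigD1 o) //= [in leRHS](bigD1 o) //= [leRHS]addrAC.
rewrite lerD //; last first.
  rewrite ler_sum // => i io; rewrite Dmx_mulE !mxE ifN ?mul1r.
    by rewrite -normCK hs_inner_canonical.
  by rewrite -[0%N]/(val o) val_eqE.
rewrite Dmx_mulE !mxE /= -hs_inner_canonical hs_inner_canonical0 // tr1 mulr1.
rewrite -normCK normrM exprMn norm0 ?addr_ge0 // normfV exprVn norm0 //.
by rewrite mulrDl divff // mul1r addrC.
Qed.

(** * Coordinates of a SIC POVM *)

Definition coord_mx (E : 'I_(d ^ 2) -> 'M[C]_d) : 'M[C]_(d ^ 2) :=
  \matrix_(i, j) hs_inner (G j) (E i).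

Lemma sic_povm_gram (Pi : 'I_(d ^ 2) -> 'M[C]_d) i j :
  is_sic_povm Pi ->
  hs_inner (Pi i) (Pi j) = (d%:R * (i == j)%:R + 1) / (d%:R + 1) / d%:R ^+ 2.
Proof.
move=> [psi [ePi gram _]]; rewrite !ePi /hs_inner -gram.
have -> : adjmx (d%:R^-1 *: (psi i *m adjmx (psi i)))
          = d%:R^-1 *: (psi i *m adjmx (psi i)).
  apply/matrixP => a b; rewrite adjmxE !mxE rmorphM /= geC0_conj ?invr_ge0 //.
  congr (_ * _); rewrite rmorph_sum; apply: eq_bigr => k _.
  by rewrite !adjmxE rmorphM /= conjCK mulrC.
rewrite -scalemxAl -scalemxAr scalerA linearZ /= mulrC -invfM -expr2.
congr (_ / _); rewrite -mulmxA mxtrace_mulC mulmxA -mulmxA trace_mx11 mxE big_ord1.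
by rewrite normCK -adjmxE adjmx_mul adjmxK.
Qed.

(** The overlap condition at i = j gives a squared norm whose square is 1; being nonnegative, it is
    1. *)
Lemma sic_povm_trace (Pi : 'I_(d ^ 2) -> 'M[C]_d) i :
  is_sic_povm Pi -> \tr (Pi i) = d%:R^-1.
Proof.
move=> [psi [ePi gram _]]; rewrite ePi linearZ /= mxtrace_mulC trace_mx11.
have /eqP := gram i i; rewrite eqxx mulr1 divff // sqrp_eq1 // => /eqP.
rewrite ger0_norm => [->|]; first by rewrite mulr1.
by rewrite adjmx_mulE sumr_ge0 // => k _; rewrite exprn_ge0.
Qed.

(* The Gram matrix of the rescaled coordinates is 1 + J/d, with J the all-ones
   matrix; their column 0 is constant, and shrinking it by sqrt(d + 1) removes
   exactly J/d. *)
Lemma sic_povm_coord (Pi : 'I_(d ^ 2) -> 'M[C]_d) :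
  is_sic_povm Pi ->
  exists2 U : 'M[C]_(d ^ 2), U \is unitarymx &
    sqrtC (d%:R * (d%:R + 1)) *: coord_mx Pi = U *m Dmx d (sqrtC (d%:R + 1)).
Proof.
move=> sicPi; set s := sqrtC _; set x := sqrtC (d%:R + 1).
have x2 : x ^+ 2 = d%:R + 1 by rewrite sqrtCK.
have s2 : s ^+ 2 = d%:R * (d%:R + 1) by rewrite sqrtCK.
have x0 : 0 <= x by rewrite sqrtC_ge0 addr_ge0.
have s0 : 0 <= s by rewrite sqrtC_ge0 mulr_ge0 // addr_ge0.
have nx : x != 0 by rewrite sqrtC_eq0.
(* The equation forces this choice, since [Dmx d x] is inverted by [Dmx d x^-1]. *)
exists (s *: coord_mx Pi *m Dmx d x^-1); last first.
  apply/matrixP => i j; rewrite !mul_DmxE -mulrA.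
  by case: ifP; rewrite ?mulVf // !mulr1.
apply/unitarymxP/matrixP => i j.
pose t k l := hs_inner (G l) (Pi k).
have t0 k : t k o = (sqrtC d%:R)^-1 / d%:R.
  by rewrite /t hs_inner_canonical0 // sic_povm_trace.
have t0_sqr k l : t k o * (t l o)^* = d%:R ^- 3.
  rewrite !t0 geC0_conj ?divr_ge0 ?invr_ge0 ?sqrtC_ge0 //.
  by rewrite mulrACA -!invfM -!expr2 sqrtCK -exprS.
(* Parseval for the Gram entry, with the index-0 term split off. *)
have pars : d%:R ^- 3 + \sum_(k | k != o) t i k * (t j k)^*
            = (d%:R * (i == j)%:R + 1) / (d%:R + 1) / d%:R ^+ 2.
  rewrite -(t0_sqr i j) (eq_sym i) -(sic_povm_gram j i sicPi).
  by rewrite (hs_inner_parseval (Pi i)) [RHS](bigD1 o).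
rewrite -[_^t*]/(adjmx _) mxE (bigD1 o) //= adjmxE !mul_DmxE /= 4!mxE.
rewrite -/(t i o) -/(t j o) !rmorphM /= geC0_conj // [(x^-1)^*]geC0_conj ?invr_ge0 //.
have -> : s * t i o / x * (s * (t j o)^* / x) = s ^+ 2 / x ^+ 2 * d%:R ^- 3.
  by rewrite -(t0_sqr i j) expr2 expr2 invfM; ring.
rewrite (eq_bigr (fun k => s ^+ 2 * (t i k * (t j k)^*))); last first.
  move=> k ko; rewrite adjmxE !mul_DmxE ifN; last first.
    by rewrite -[0%N]/(val o) val_eqE.
  by rewrite !mulr1 !mxE rmorphM /= (geC0_conj s0) mulrACA.
(* The index-0 term is now 1/d^2, and the remaining ones sum to the Kronecker delta minus 1/d^2. *)
rewrite -mulr_sumr -[\sum_(k | _) _](addKr (d%:R ^- 3)) pars s2 x2 mxE.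
by field; rewrite d_neq0 d1_neq0.
Qed.

End CanonicalBasis.

(** * Correlation matrices under change of operators, and the two trace norm statements *)

Section Correlations.
Variable C : numClosedFieldType.

Lemma mxtrace_tens m n (A : 'M[C]_m) (B : 'M[C]_n) :
  \tr (A *t B) = \tr A * \tr B.
Proof.
rewrite /mxtrace mulr_sum; apply: eq_bigr => k _.
by case: (mxtens_indexP k) => i j; rewrite tensmxE mxtens_indexK.
Qed.

Variables (dA dB : nat) (GA : 'I_(dA ^ 2) -> 'M[C]_dA) (GB : 'I_(dB ^ 2) -> 'M[C]_dB).
Hypotheses (hGA : is_canonical_basis GA) (hGB : is_canonical_basis GB).

(** Expand both factors of [EA a *t EB b] in the canonical bases. The entries are bilinear in the
    two factors, hence a plain transpose on the right and not an adjoint. *)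
Lemma correlation_mx_coord (rho : 'M[C]_(dA * dB)) EA EB :
  correlation_mx rho EA EB =
  coord_mx GA EA *m correlation_mx rho GA GB *m (coord_mx GB EB)^T.
Proof.
apply/matrixP => a b; rewrite mxE.
have -> : EA a *t EB b = \sum_j \sum_i
    (hs_inner (GA i) (EA a) * hs_inner (GB j) (EB b)) *: (GA i *t GB j).
  rewrite {1}(canonical_basis_expand hGA (EA a)).
  rewrite {1}(canonical_basis_expand hGB (EB b)).
  apply/matrixP => k l; case: (mxtens_indexP k) => k1 k2.
  case: (mxtens_indexP l) => l1 l2; rewrite tensmxE !summxE big_distrr /=.
  apply: eq_bigr => j _; rewrite summxE big_distrl /=; apply: eq_bigr => i _.
  by rewrite mxE [in RHS]mxE tensmxE [in LHS]mxE mulrACA.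
rewrite mulmx_sumr raddf_sum mxE; apply: eq_bigr => j _ /=.
rewrite mulmx_sumr raddf_sum mxE big_distrl; apply: eq_bigr => i _ /=.
by rewrite -scalemxAr linearZ /= !mxE mulrAC.
Qed.

Lemma correlation_mx_product_sum N (p : 'I_N -> C) rhoA rhoB :
  correlation_mx (\sum_k p k *: (rhoA k *t rhoB k)) GA GB =
  \sum_k p k *: ((\col_i \tr (rhoA k *m GA i)) *m (\col_j \tr (rhoB k *m GB j))^T).
Proof.
apply/matrixP => i j; rewrite mxE mulmx_suml raddf_sum summxE.
apply: eq_bigr => k _ /=; rewrite -scalemxAl linearZ /= tensmx_mul mxtrace_tens.
by rewrite !mxE big_ord1 !mxE.
Qed.

(** An empty matrix has trace 0, not 1. Positivity of the dimension is what provides the index 0 of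
    a canonical basis. *)
Lemma density_dim_gt0 n (r : 'M[C]_n) : density r -> (0 < n)%N.
Proof.
case: n r => // r [_ /eqP]; rewrite /mxtrace big_ord0 eq_sym.
by rewrite oner_eq0.
Qed.

Lemma sic_povm_trnorm (rho : 'M[C]_(dA * dB)) PiA PiB :
  (0 < dA)%N -> (0 < dB)%N -> is_sic_povm PiA -> is_sic_povm PiB ->
  sqrtC (dA%:R * (dA%:R + 1) * dB%:R * (dB%:R + 1)) *
    trnorm (correlation_mx rho PiA PiB) =
  trnorm (Dmx dA (sqrtC (dA%:R + 1)) *m correlation_mx rho GA GB
            *m Dmx dB (sqrtC (dB%:R + 1))).
Proof.
move=> dA0 dB0 sicA sicB.
have [U uU eU] := sic_povm_coord hGA dA0 sicA.
have [V uV eV] := sic_povm_coord hGB dB0 sicB.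
rewrite -trnorm_scale ?sqrtC_ge0 ?mulr_ge0 ?addr_ge0 //.
(* The constant splits into one factor per side, each absorbed by the coordinate matrix of its own
   SIC POVM. *)
rewrite -mulrA sqrtCM ?nnegrE ?mulr_ge0 ?addr_ge0 //.
rewrite (correlation_mx_coord rho PiA PiB) -scalerA scalemxAr.
rewrite -[_ *: (coord_mx _ PiB)^T]linearZ /= eV !scalemxAl eU.
rewrite trmx_mul tr_diag_mx -[RHS](trnorm_unitary _ uU (_ : V^T \is unitarymx)).
  by rewrite !mulmxA.
by rewrite trmx_unitary.
Qed.

Lemma separable_trnorm_le2 (rho : 'M[C]_(dA * dB)) :
  (0 < dA)%N -> (0 < dB)%N -> separable rho ->
  trnorm (Dmx dA (sqrtC (dA%:R + 1)) *m correlation_mx rho GA GB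
            *m Dmx dB (sqrtC (dB%:R + 1))) <= 2.
Proof.
move=> dA0 dB0 [N [p [rhoA [rhoB [p0 p1 dnA dnB ->]]]]].
rewrite correlation_mx_product_sum mulmx_sumr mulmx_suml.
(* The diagonal weights keep every product term of rank one, each weight acting on its own
   vector. *)
have DuvD x y (u : 'cV[C]_(dA ^ 2)) (v : 'cV[C]_(dB ^ 2)) :
    Dmx dA x *m (u *m v^T) *m Dmx dB y = (Dmx dA x *m u) *m (Dmx dB y *m v)^T.
  by rewrite trmx_mul tr_diag_mx !mulmxA.
under eq_bigr => k _ do rewrite -scalemxAr -scalemxAl DuvD.
by apply: trnorm_convex_rank1 => // k; apply: density_coord_norm.
Qed.

Lemma le_div_scale (c t u b : C) :
  0 < c -> c * t = u -> (t <= b / c <-> u <= b).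
Proof. by move=> c0 <-; rewrite ler_pdivlMr // mulrC. Qed.

End Correlations.

Theorem mainTheorem2 (R : realType) (dA dB : nat) (hd : (dA <= dB)%N)
  (GA : 'I_(dA ^ 2) -> 'M[R[i]]_dA) (GB : 'I_(dB ^ 2) -> 'M[R[i]]_dB)
  (hGA : is_canonical_basis GA) (hGB : is_canonical_basis GB)
  (rho : 'M[R[i]]_(dA * dB)) (hrho : density rho) :
  let x : R[i] := sqrtC (dA%:R + 1) in
  let y : R[i] := sqrtC (dB%:R + 1) in
  let Ccan := correlation_mx rho GA GB in
  let c : R[i] := sqrtC (dA%:R * (dA%:R + 1) * dB%:R * (dB%:R + 1)) in
  (forall (PiA : 'I_(dA ^ 2) -> 'M[R[i]]_dA) (PiB : 'I_(dB ^ 2) -> 'M[R[i]]_dB),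
      is_sic_povm PiA -> is_sic_povm PiB ->
      let P := correlation_mx rho PiA PiB in
      c * trnorm P = trnorm (Dmx dA x *m Ccan *m Dmx dB y)
      /\ (trnorm P <= 2 / c <-> trnorm (Dmx dA x *m Ccan *m Dmx dB y) <= 2))
  /\ (separable rho -> trnorm (Dmx dA x *m Ccan *m Dmx dB y) <= 2).
Proof.
(* A density operator on the tensor product makes both dimensions positive. *)
have := density_dim_gt0 hrho; rewrite muln_gt0 => /andP[dA0 dB0] x y Ccan c.
split=> [PiA PiB sicA sicB P|]; last exact: separable_trnorm_le2.
have cP := sic_povm_trnorm hGA hGB rho dA0 dB0 sicA sicB; split; first exact: cP.
have c0 : 0 < c.
  by rewrite sqrtC_gt0 !mulr_gt0 // ?ltr_wpDl ?ltr0n.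
exact: le_div_scale c0 cP.
Qed.
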